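(* Let $(\xi_n)_n$ be $[0,\infty)$-valued random variables on $(\Omega,\mathcal{G},\mathbb{P})$, let $\mathcal{F}\subset\mathcal{G}$ be a sub-$\sigma$-algebra, and let $C:=\mathrm{conv}\{\xi_n:n\in\mathbb{N}\}$. Assume that for every $\epsilon\in L^0_+(\mathcal{F})$ there exists $a\in L^0(\mathcal{F})$ such that $\mathbb{P}(h\ge a\mid\mathcal{F})\le\epsilon$ for all $h\in C$. Then there exist a $[0,\infty)$-valued random variable $X$ and a sequence $(x_n)$ with $x_n\in\mathrm{conv}\{\xi_n,\xi_{n+1},\dots\}$ such that $x_n\to X$ almost surely.
   Context: $L^0(\mathcal{F})$ denotes a.s. finite real $\mathcal{F}$-measurable random variables and $L^0_+(\mathcal{F})$ its nonnegative elements; $\mathrm{conv}$ denotes the (finite) convex hull; inequalities are a.s. *)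

(* Defs.v *)
From HB Require Import structures.
From mathcomp Require Import all_boot all_order all_algebra.
From mathcomp Require Import all_classical all_reals all_analysis.
Set Implicit Arguments. Unset Strict Implicit. Unset Printing Implicit Defensive.
Import Order.TTheory GRing.Theory Num.Theory.
Import numFieldNormedType.Exports.
Local Open Scope classical_set_scope.
Local Open Scope ring_scope.

(* A sub-sigma-algebra F of the sigma-algebra [measurable] of T (= G). *)
Definition is_subsigma d (T : measurableType d) (F : set (set T)) :=
  sigma_algebra setT F /\ F `<=` measurable.

Definition Fmeasurable d (T : measurableType d) (R : realType)
  (F : set (set T)) (f : T -> R) :=
  forall B : set R, measurable B -> F (f @^-1` B).

(* Y is a version of the conditional probability P(A | F):
   Y is F-measurable, integrable, and E[Y 1_B] = P(A /\ B) for all B in F. *)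
Definition cond_prob_version d (T : measurableType d) (R : realType)
  (P : probability T R) (F : set (set T)) (A : set T) (Y : T -> R) :=
  [/\ Fmeasurable F Y, P.-integrable setT (EFin \o Y) &
      forall B, F B -> (\int[P]_(w in B) (Y w)%:E = P (A `&` B))%E].

Definition cond_prob_le d (T : measurableType d) (R : realType)
  (P : probability T R) (F : set (set T)) (A : set T) (eps : T -> R) :=
  exists Y, cond_prob_version P F A Y /\ {ae P, forall w, Y w <= eps w}.

(* h belongs to conv{ xi_n, xi_{n+1}, ... } (finite convex combinations
   with deterministic weights). *)
Definition in_tail_conv (T : Type) (R : realType) (xi : nat -> T -> R)
  (n : nat) (h : T -> R) :=
  exists (m : nat) (lam : nat -> R),
    [/\ forall i, 0 <= lam i, \sum_(n <= i < m) lam i = 1 &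
        h = (fun w => \sum_(n <= i < m) lam i * xi i w)].

(* Main.v *)
Require Import Defs.
From HB Require Import structures.
From mathcomp Require Import all_boot all_order all_algebra.
From mathcomp Require Import all_classical all_reals all_analysis.
From mathcomp Require Import measurable_realfun ring lra.
Set Implicit Arguments. Unset Strict Implicit. Unset Printing Implicit Defensive.
Import Order.TTheory GRing.Theory Num.Theory.
Import numFieldNormedType.Exports.
Local Open Scope classical_set_scope.
Local Open Scope ring_scope.

(* Taking eps = 0 in the hypothesis yields an F-measurable a with P(a <= xi_n) = 0,
   so xi_n <= a almost surely for every n and, off a null set, xi_n / (1 + |a|) is
   a [0,1]-valued sequence g_n.  For such a sequence a Komlos-type L^2 argument
   applies: the infimum s_n of E h^2 over convex combinations h of g_n, g_(n+1), ...
   increases to some sigma <= 1.  Near-minimisers h_k chosen deep enough in the tail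
   satisfy E (h_k - h_(k+1))^2 <= 8 e_k by the parallelogram law, and a summable choice
   of e_k makes sum_k |h_k - h_(k+1)| finite almost surely, so h_k converges almost
   surely.  Multiplying back by 1 + |a| gives the x_n. *)

Section Weights.
Variable R : realType.

(* Weights vanish outside [n, m), so sums may be taken over [0, m) and the lower
   bound n may be lowered freely. *)
Definition tail_weights (n m : nat) (lam : nat -> R) :=
  [/\ forall i, 0 <= lam i, forall i, ~~ (n <= i < m)%N -> lam i = 0
    & \sum_(0 <= i < m) lam i = 1].

Definition wsum {T : Type} (lam : nat -> R) (m : nat) (g : nat -> T -> R)
  (w : T) : R := \sum_(0 <= i < m) lam i * g i w.

Lemma tail_weightsW n n' m lam :
  (n' <= n)%N -> tail_weights n m lam -> tail_weights n' m lam.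
Proof.
move=> n'n [lam0 lam_out lam1]; split=> // i i_out; apply: lam_out.
by apply: contra i_out => /andP[ni ->]; rewrite (leq_trans n'n).
Qed.

Lemma tail_weights_sum_widen n m M lam (F : nat -> R) :
  tail_weights n m lam -> (m <= M)%N ->
  \sum_(0 <= i < M) lam i * F i = \sum_(0 <= i < m) lam i * F i.
Proof.
case=> _ lam_out _ mM; rewrite (big_cat_nat (leq0n m) mM) /=.
rewrite [X in _ + X]big_nat_cond [X in _ + X]big1 ?addr0 // => i /andP[/andP[mi _] _].
by rewrite lam_out ?mul0r // negb_and -leqNgt mi orbT.
Qed.

Lemma wsum_widen {T : Type} n m M lam (g : nat -> T -> R) w :
  tail_weights n m lam -> (m <= M)%N -> wsum lam M g w = wsum lam m g w.
Proof. exact: tail_weights_sum_widen. Qed.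

Lemma tail_weights_sum1 n m M lam :
  tail_weights n m lam -> (m <= M)%N -> \sum_(0 <= i < M) lam i = 1.
Proof.
move=> wl mM; have [_ _ <-] := wl.
have := tail_weights_sum_widen (fun=> 1) wl mM.
by under eq_bigr do rewrite mulr1; under [RHS]eq_bigr do rewrite mulr1.
Qed.

Lemma tail_weights_unit n : tail_weights n n.+1 (fun i => (i == n)%:R).
Proof.
split=> [i|i|]; first by rewrite ler0n.
  by rewrite ltnS -eqn_leq eq_sym => /negbTE ->.
rewrite big_nat_recr //= eqxx big_nat_cond big1 ?add0r // => i /andP[/andP[_]].
by move/ltn_eqF => ->.
Qed.

Lemma wsum_unit {T : Type} n (g : nat -> T -> R) w :
  wsum (fun i => (i == n)%:R) n.+1 g w = g n w.
Proof.
rewrite /wsum big_nat_recr //= eqxx mul1r big_nat_cond big1 ?add0r //.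
by move=> i /andP[/andP[_ /ltn_eqF ->] _]; rewrite mul0r.
Qed.

Definition mid_weights (l1 l2 : nat -> R) i := (l1 i + l2 i) / 2.

Lemma tail_weights_mid n m1 m2 l1 l2 :
  tail_weights n m1 l1 -> tail_weights n m2 l2 ->
  tail_weights n (maxn m1 m2) (mid_weights l1 l2).
Proof.
move=> w1 w2; have [l1_0 l1_out l1_1] := w1; have [l2_0 l2_out l2_1] := w2.
split=> [i|i i_out|].
- by rewrite divr_ge0 ?addr_ge0.
- rewrite /mid_weights l1_out ?l2_out ?addr0 ?mul0r //; apply: contra i_out;
    by move=> /andP[-> /leq_trans->] //; rewrite ?leq_maxl ?leq_maxr.
- rewrite /mid_weights -big_distrl big_split /=.
  rewrite (tail_weights_sum1 w1 (leq_maxl _ _)) (tail_weights_sum1 w2 (leq_maxr _ _)).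
  by rewrite divff // pnatr_eq0.
Qed.
End Weights.

Section WeightedSums.
Variables (R : realType) (T : Type).
Implicit Types (g : nat -> T -> R) (lam : nat -> R).

Lemma wsum_mid n m1 m2 l1 l2 g w :
  tail_weights n m1 l1 -> tail_weights n m2 l2 ->
  wsum (mid_weights l1 l2) (maxn m1 m2) g w = (wsum l1 m1 g w + wsum l2 m2 g w) / 2.
Proof.
move=> w1 w2; rewrite -(wsum_widen _ _ w1 (leq_maxl _ m2)).
rewrite -(wsum_widen _ _ w2 (leq_maxr m1 _)) /wsum -big_split big_distrl /=.
by apply: eq_bigr => i _; rewrite /mid_weights; ring.
Qed.

Lemma wsum_mulr lam m g c w :
  wsum lam m (fun i w => g i w * c w) w = wsum lam m g w * c w.
Proof. by rewrite /wsum big_distrl; apply: eq_bigr => i _; rewrite mulrA. Qed.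

Lemma wsum_ge0 n m lam g w :
  (forall i, 0 <= g i w) -> tail_weights n m lam -> 0 <= wsum lam m g w.
Proof. by move=> g0 [lam0 _ _]; apply: sumr_ge0 => i _; rewrite mulr_ge0. Qed.

Lemma wsum_le1 n m lam g w :
  (forall i, g i w <= 1) -> tail_weights n m lam -> wsum lam m g w <= 1.
Proof.
move=> g1 [lam0 _ <-]; apply: ler_sum => i _.
by rewrite -[leRHS]mulr1 ler_wpM2l.
Qed.

Lemma tail_weights_in_tail_conv n m lam g :
  tail_weights n m lam -> in_tail_conv g n (wsum lam m g).
Proof.
move=> wl; have [lam0 lam_out lam1] := wl.
have nm : (n <= m)%N.
  rewrite leqNgt; apply/negP => mn; move: lam1; rewrite big_nat_cond big1.
    by move/eqP; rewrite eq_sym oner_eq0.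
  by move=> i /andP[/andP[_ im] _]; rewrite lam_out // leqNgt (ltn_trans im mn).
have dropl F : \sum_(0 <= i < m) lam i * F i = \sum_(n <= i < m) lam i * F i.
  rewrite (big_cat_nat (leq0n n) nm) /= big_nat_cond big1 ?add0r // => i.
  by move=> /andP[/andP[_ ni] _]; rewrite lam_out ?mul0r // leqNgt ni.
exists m, lam; split=> //.
  by rewrite -lam1 -(eq_bigr _ (fun i _ => mulr1 (lam i))) -dropl
    (eq_bigr _ (fun i _ => mulr1 (lam i))).
by apply/funext => w; rewrite /wsum dropl.
Qed.

Lemma in_tail_conv_term g n : in_tail_conv g 0 (g n).
Proof.
have -> : g n = wsum (fun i => (i == n)%:R) n.+1 g.
  by apply/funext => w; rewrite wsum_unit.
exact/tail_weights_in_tail_conv/(tail_weightsW (leq0n n))/tail_weights_unit.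
Qed.

End WeightedSums.

Lemma measurable_wsum d (T : measurableType d) (R : realType) lam m
  (g : nat -> T -> R) :
  (forall i, measurable_fun setT (g i)) -> measurable_fun setT (wsum lam m g).
Proof.
move=> mg; apply: measurable_sum => i.
by apply: measurable_funM => //; exact: measurable_cst.
Qed.

Section MeanSquare.
Context d (T : measurableType d) (R : realType) (P : probability T R).
Implicit Types h : T -> R.

Lemma bounded_integrable h (M : R) : measurable_fun setT h ->
  (forall w, `|h w| <= M) -> P.-integrable setT (EFin \o h).
Proof.
move=> mh hM; apply: measurable_bounded_integrable => //.
  by rewrite /= probability_setT ltry.
exists M; split; first by rewrite num_real.
by move=> M' MM' w _; exact: le_trans (hM w) (ltW MM').
Qed.

Lemma integrableZl_real (k : R) h : P.-integrable setT (EFin \o h) ->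
  P.-integrable setT (EFin \o (fun w => k * h w)).
Proof.
move=> ih; apply: (eq_integrable measurableT (fun w => k%:E * (EFin \o h) w)%E).
  by move=> w _ /=; rewrite EFinM.
exact: integrableZl.
Qed.

Lemma integrableD_real h1 h2 : P.-integrable setT (EFin \o h1) ->
  P.-integrable setT (EFin \o h2) ->
  P.-integrable setT (EFin \o (fun w => h1 w + h2 w)).
Proof.
move=> i1 i2; apply: (eq_integrable measurableT ((EFin \o h1) \+ (EFin \o h2))%E).
  by move=> w _ /=; rewrite EFinD.
exact: integrableD.
Qed.

Definition msq h := \int[P]_w (h w ^+ 2).

Lemma msq_ge0 h : 0 <= msq h.
Proof. by apply: Rintegral_ge0 => w _; exact: sqr_ge0. Qed.

Lemma integrable_sqr_le1 h : measurable_fun setT h -> (forall w, `|h w| <= 1) ->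
  P.-integrable setT (EFin \o (fun w => h w ^+ 2)).
Proof.
move=> mh h1; apply: (bounded_integrable (M := 1)); first exact: measurable_funX.
by move=> w; rewrite normrX expr_le1.
Qed.

Lemma msqE h : measurable_fun setT h -> (forall w, `|h w| <= 1) ->
  (\int[P]_w (h w ^+ 2)%:E)%E = (msq h)%:E.
Proof.
move=> mh h1; rewrite /msq /Rintegral fineK //.
exact: (integrable_fin_num measurableT (integrable_sqr_le1 mh h1)).
Qed.

Lemma msq_le1 h : measurable_fun setT h -> (forall w, `|h w| <= 1) -> msq h <= 1.
Proof.
move=> mh h1; have := @le_Rintegral _ _ _ P setT _ (fun=> 1) measurableT.
rewrite Rintegral_cst // /= probability_setT mul1r; apply.
- exact: integrable_sqr_le1.
- by apply: (bounded_integrable (M := 1)) => // w; rewrite normr1.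
- by move=> w _; rewrite -real_normK ?num_real ?expr_le1.
Qed.

Lemma msq_parallelogram h1 h2 : measurable_fun setT h1 -> measurable_fun setT h2 ->
  (forall w, `|h1 w| <= 1) -> (forall w, `|h2 w| <= 1) ->
  msq (fun w => h1 w - h2 w) =
  2 * msq h1 + 2 * msq h2 - 4 * msq (fun w => (h1 w + h2 w) / 2).
Proof.
move=> m1 m2 b1 b2.
have mmid : measurable_fun setT (fun w => (h1 w + h2 w) / 2).
  by apply: measurable_funM => //; exact: measurable_funD.
have bmid w : `|(h1 w + h2 w) / 2| <= 1.
  rewrite normrM normfV normr_nat ler_pdivrMr // mul1r.
  by rewrite (le_trans (ler_normD _ _)) //; have := b1 w; have := b2 w; lra.
have i1 := integrable_sqr_le1 m1 b1; have i2 := integrable_sqr_le1 m2 b2.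
have i3 := integrable_sqr_le1 mmid bmid.
rewrite /msq -!RintegralZl // -RintegralD ?integrableZl_real //.
rewrite -RintegralB ?integrableD_real ?integrableZl_real //.
by apply: eq_Rintegral => w _; field.
Qed.

End MeanSquare.

Lemma cvgn_bounded_variation (R : realType) (u : R ^nat) (C : R) :
  (forall K, \sum_(0 <= k < K) `|u k.+1 - u k| <= C) -> cvgn u.
Proof.
move=> uC; pose du k := u k.+1 - u k.
have : cvgn (series du).
  apply: normed_cvg; apply: nondecreasing_is_cvgn.
    exact: (@nondecreasing_series _ (fun k => `|du k|) xpredT).
  by exists C => _ [K _ <-]; exact: uC.
have -> : u = (fun=> u 0%N) + series du.
  by apply/funext => K; rewrite fctE /series /= /du telescope_sumr // addrC subrK.
exact: is_cvgD (is_cvg_cst _).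
Qed.

Lemma sum_inv_pow2_le1 (R : realType) K :
  \sum_(0 <= k < K) (2 ^+ k.+1 : R)^-1 <= 1.
Proof.
suff -> : \sum_(0 <= k < K) (2 ^+ k.+1 : R)^-1 = 1 - (2 ^+ K)^-1.
  by rewrite gerBl invr_ge0 exprn_ge0.
elim: K => [|K IH]; first by rewrite big_geq // expr0 invr1 subrr.
rewrite big_nat_recr //= IH exprS; field.
by rewrite expf_neq0.
Qed.

Lemma ae_bounded_partial_sums d (T : measurableType d) (R : realType)
  (mu : {measure set T -> \bar R}) (phi : nat -> T -> R) (c : R ^nat) (C : R) :
  (forall k, measurable_fun setT (phi k)) -> (forall k w, 0 <= phi k w) ->
  (forall k, (\int[mu]_w (phi k w)%:E <= (c k)%:E)%E) ->
  (forall K, \sum_(0 <= k < K) c k <= C) ->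
  {ae mu, forall w, exists C', forall K, \sum_(0 <= k < K) phi k w <= C'}.
Proof.
move=> mphi phi0 int_phi cC; pose S w := (\sum_(k <oo) (phi k w)%:E)%E.
have S0 w : (0 <= S w)%E by apply: nneseries_ge0 => k _ _; rewrite lee_fin.
have mS : measurable_fun setT S.
  apply: (@ge0_emeasurable_sum _ _ _ setT _ xpredT).
    by move=> k w _ _; rewrite lee_fin.
  by move=> k _; apply/measurable_EFinP.
have intS : mu.-integrable setT S.
  apply/integrableP; split=> //; under eq_integral do rewrite gee0_abs //.
  rewrite integral_nneseries //; last 2 first.
  - by move=> k; apply/measurable_EFinP.
  - by move=> k w _; rewrite lee_fin.
  apply: (@le_lt_trans _ _ C%:E); last exact: ltry.
  apply: lime_le.
    by apply: is_cvg_nneseries => k _ _; apply: integral_ge0 => w _; rewrite lee_fin.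
  apply: nearW => K; apply: (@le_trans _ _ (\sum_(0 <= k < K) c k)%:E).
    by rewrite -sumEFin; apply: lee_sum => k _; exact: int_phi.
  by rewrite lee_fin.
apply: filterS (integrable_ae measurableT intS) => w /(_ I) Sfin.
exists (fine (S w)) => K; rewrite -lee_fin fineK // -sumEFin.
by apply: nneseries_lim_ge => k _ _; rewrite lee_fin.
Qed.

Lemma norm_le_inv_add_sqr (R : realFieldType) (t x : R) :
  0 < t -> `|x| <= t^-1 + t * x ^+ 2.
Proof.
move=> t0; rewrite -(real_normK (num_real x)).
have : 0 <= `|x| by [].
move: `|x| => y y0; rewrite -(ler_pM2l t0) mulrDr mulfV ?gt_eqF //; nra.
Qed.

Section Komlos.
Context d (T : measurableType d) (R : realType) (P : probability T R).
Variable g : nat -> T -> R.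
Hypothesis mg : forall i, measurable_fun setT (g i).
Hypothesis g01 : forall i w, 0 <= g i w <= 1.

Lemma wsum_norm_le1 n m lam w : tail_weights n m lam -> `|wsum lam m g w| <= 1.
Proof.
move=> wl; rewrite ger0_norm; first by apply: wsum_le1 wl => i; case/andP: (g01 i w).
by apply: wsum_ge0 wl => i; case/andP: (g01 i w).
Qed.

Definition tail_msq n :=
  [set r | exists lam m, tail_weights n m lam /\ r = msq P (wsum lam m g)].

Definition msq_inf n := inf (tail_msq n).

Definition msq_sup := sup (range msq_inf).

Lemma has_inf_tail_msq n : has_inf (tail_msq n).
Proof.
split; last by exists 0 => _ [lam [m [_ ->]]]; exact: msq_ge0.
by exists (msq P (wsum (fun i => (i == n)%:R) n.+1 g)), (fun i => (i == n)%:R), n.+1;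
  split => //; exact: tail_weights_unit.
Qed.

Lemma msq_inf_le n m lam :
  tail_weights n m lam -> msq_inf n <= msq P (wsum lam m g).
Proof. by move=> wl; apply: (ge_inf (has_inf_tail_msq n).2); exists lam, m. Qed.

Lemma msq_inf_homo : {homo msq_inf : n n' / (n <= n')%N >-> n <= n'}.
Proof.
move=> n n' nn'; apply: lb_le_inf; first exact: (has_inf_tail_msq n').1.
by move=> _ [lam [m [wl ->]]]; apply: msq_inf_le; exact: tail_weightsW wl.
Qed.

Lemma msq_inf_le1 n : msq_inf n <= 1.
Proof.
have wl := tail_weights_unit R n; apply: le_trans (msq_inf_le wl) _.
apply: msq_le1; first exact: measurable_wsum.
by move=> w; exact: wsum_norm_le1 wl.
Qed.

Lemma has_sup_msq_inf : has_sup (range msq_inf).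
Proof.
by split; [exists (msq_inf 0), 0%N | exists 1 => _ [n _ <-]; exact: msq_inf_le1].
Qed.

Lemma msq_inf_le_sup n : msq_inf n <= msq_sup.
Proof. by apply: sup_upper_bound; [exact: has_sup_msq_inf | exists n]. Qed.

Lemma near_minimizers (e : R ^nat) : (forall k, 0 < e k) ->
  exists (mu : nat -> nat) (L : nat -> nat -> R) (M : nat -> nat),
  forall k, [/\ (k <= mu k)%N, (mu k <= mu k.+1)%N, msq_sup - e k < msq_inf (mu k),
    tail_weights (mu k) (M k) (L k) & msq P (wsum (L k) (M k) g) < msq_sup + e k].
Proof.
move=> e_gt0.
have /choice[nu nuP] k : exists n, msq_sup - e k < msq_inf n.
  by have [_ [n _ <-]] := sup_adherent (e_gt0 k) has_sup_msq_inf; exists n.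
pose mu k := (k + \sum_(j < k.+1) nu j)%N.
have nu_le_mu k : (nu k <= mu k)%N.
  by rewrite /mu big_ord_recr /= addnA leq_addl.
have /choice[LM LMP] k : exists p : (nat -> R) * nat,
    tail_weights (mu k) p.2 p.1 /\ msq P (wsum p.1 p.2 g) < msq_inf (mu k) + e k.
  have [_ [lam [m [wl ->]]] lt_e] := inf_adherent (e_gt0 k) (has_inf_tail_msq (mu k)).
  by exists (lam, m).
exists mu, (fun k => (LM k).1), (fun k => (LM k).2) => k.
have [wl lt_e] := LMP k; split=> //.
- exact: leq_addr.
- by apply: leq_add => //; rewrite [X in (_ <= X)%N]big_ord_recr leq_addr.
- exact: lt_le_trans (nuP k) (msq_inf_homo (nu_le_mu k)).
- by apply: lt_le_trans lt_e _; rewrite lerD2r msq_inf_le_sup.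
Qed.

Lemma msq_sub_lt n m1 m2 l1 l2 eps :
  msq_sup - eps < msq_inf n -> tail_weights n m1 l1 -> tail_weights n m2 l2 ->
  msq P (wsum l1 m1 g) < msq_sup + eps -> msq P (wsum l2 m2 g) < msq_sup + eps ->
  msq P (fun w => wsum l1 m1 g w - wsum l2 m2 g w) < 8 * eps.
Proof.
move=> lt_inf w1 w2 lt1 lt2.
have mid_ge : msq_inf n <= msq P (fun w => (wsum l1 m1 g w + wsum l2 m2 g w) / 2).
  rewrite (_ : (fun w => _) = wsum (mid_weights l1 l2) (maxn m1 m2) g).
    exact/msq_inf_le/tail_weights_mid.
  by apply/funext => w; rewrite (wsum_mid _ _ w1 w2).
rewrite msq_parallelogram; try exact: measurable_wsum.
- by move: lt_inf lt1 lt2 mid_ge; lra.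
- by move=> w; exact: wsum_norm_le1 w1.
- by move=> w; exact: wsum_norm_le1 w2.
Qed.

Lemma komlos_bounded : exists (L : nat -> nat -> R) (M : nat -> nat),
  (forall k, tail_weights k (M k) (L k)) /\
  {ae P, forall w, cvgn (fun k => wsum (L k) (M k) g w)}.
Proof.
(* With t_k = 2^(k+1) and e_k = 1 / (8 t_k^2) one gets E (h_k - h_(k+1))^2 <= 1 / t_k^2,
   and |y| <= 1/t + t y^2 splits sum_k |h_k - h_(k+1)| into sum_k 1/t_k <= 1 and a
   series that is integrable, hence finite almost surely. *)
pose t k : R := 2 ^+ k.+1.
have t_gt0 k : 0 < t k by exact: exprn_gt0.
have t2_gt0 k : 0 < 8 * t k ^+ 2 by rewrite mulr_gt0 // exprn_gt0.
pose e k := (8 * t k ^+ 2)^-1.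
have e_gt0 k : 0 < e k by rewrite invr_gt0.
have [mu [L [M near]]] := near_minimizers e_gt0.
exists L, M; split=> [k|].
  by have [k_mu _ _ wl _] := near k; exact: tail_weightsW wl.
pose h k := wsum (L k) (M k) g.
have h01 k w : 0 <= h k w <= 1.
  have [_ _ _ wl _] := near k; apply/andP; split.
    by apply: wsum_ge0 wl => i; case/andP: (g01 i w).
  by apply: wsum_le1 wl => i; case/andP: (g01 i w).
pose dh k w := h k w - h k.+1 w.
have mdh k : measurable_fun setT (dh k).
  by apply: measurable_funB; exact: measurable_wsum.
have dh1 k w : `|dh k w| <= 1.
  move: (h01 k w) (h01 k.+1 w) => /andP[? ?] /andP[? ?].
  by rewrite ler_norml /dh; apply/andP; split; lra.
have msq_dh k : msq P (dh k) <= (t k ^+ 2)^-1.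
  have [_ mu_le lt_inf wl lt_sup] := near k; have [_ _ _ wl' lt_sup'] := near k.+1.
  have e_le : e k.+1 <= e k.
    rewrite lef_pV2 ?posrE ?t2_gt0 // ler_pM2l // ler_pXn2r ?nnegrE ?(ltW (t_gt0 _)) //.
    by rewrite /t ler_eXn2l // ltr1n.
  rewrite (_ : (t k ^+ 2)^-1 = 8 * e k); last by rewrite /e; field; rewrite gt_eqF.
  apply/ltW/(msq_sub_lt lt_inf wl (tail_weightsW mu_le wl') lt_sup).
  by apply: lt_le_trans lt_sup' _; rewrite lerD2l.
pose phi k w := t k * dh k w ^+ 2.
have mphi k : measurable_fun setT (phi k).
  by apply: measurable_funM; [exact: measurable_cst | exact: measurable_funX].
have phi0 k w : 0 <= phi k w by rewrite mulr_ge0 ?sqr_ge0 ?ltW.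
have int_phi k : (\int[P]_w (phi k w)%:E <= ((t k)^-1)%:E)%E.
  under eq_integral do rewrite EFinM.
  rewrite ge0_integralZl_EFin ?(ltW (t_gt0 k)) //; last 2 first.
  - by move=> w _; rewrite lee_fin sqr_ge0.
  - by apply/measurable_EFinP; exact: measurable_funX.
  rewrite [X in (_ * X)%E](_ : _ = (msq P (dh k))%:E); last exact: msqE.
  rewrite -EFinM lee_fin.
  apply: le_trans (ler_wpM2l (ltW (t_gt0 k)) (msq_dh k)) _.
  by rewrite expr2 invfM mulrA mulfV ?mul1r ?gt_eqF.
have := ae_bounded_partial_sums mphi phi0 int_phi (@sum_inv_pow2_le1 R).
apply: filterS => w [C sumC]; apply: (@cvgn_bounded_variation _ _ (1 + C)) => K.
apply: le_trans (lerD (sum_inv_pow2_le1 R K) (sumC K)); rewrite -big_split.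
by apply: ler_sum => k _; rewrite distrC; exact: norm_le_inv_add_sqr.
Qed.

End Komlos.

Lemma ae_cvg_measurable_limit d (T : measurableType d) (R : realType)
  (mu : {measure set T -> \bar R}) (x : nat -> T -> R) :
  (forall k, measurable_fun setT (x k)) -> (forall k w, 0 <= x k w) ->
  {ae mu, forall w, cvgn (x^~ w)} ->
  exists X : T -> R, [/\ measurable_fun setT X, forall w, 0 <= X w &
    {ae mu, forall w, x^~ w @ \oo --> X w}].
Proof.
move=> mx x0 cvg_x.
(* A limsup rather than a limit keeps X measurable without knowing where x converges. *)
pose X w := Num.max (fine (limn_esup (fun k => (x k w)%:E))) 0.
exists X; split=> [||].
- apply: measurable_maxr; last exact: measurable_cst.
  apply: measurableT_comp; first exact: fine_measurable.
  by apply: measurable_fun_limn_esup => k; apply/measurable_EFinP.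
- by move=> w; rewrite /X le_max lexx orbT.
- apply: filterS cvg_x => w cvg_xw.
  have lim_ge0 : 0 <= limn (x^~ w).
    by apply: limr_ge => //; apply: nearW => k.
  suff -> : X w = limn (x^~ w) by [].
  have /cvg_limn_einf_sup[_ lim_sup] : (fun k => (x k w)%:E) @ \oo --> (limn (x^~ w))%:E.
    by apply: cvg_EFin; [exact: nearW | exact: cvg_xw].
  by rewrite /X lim_sup /= max_l.
Qed.

Lemma subsigma_setT d (T : measurableType d) (F : set (set T)) :
  is_subsigma F -> F setT.
Proof. by move=> [[F0 FC _] _]; rewrite -setC0 -setTD; exact: FC. Qed.

Lemma cond_prob_le0_null d (T : measurableType d) (R : realType)
  (P : probability T R) (F : set (set T)) (A : set T) :
  is_subsigma F -> cond_prob_le P F A (fun=> 0) -> P A = 0%E.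
Proof.
move=> subF [Y [[FY _ EY] Y_le0]]; have FT := subsigma_setT subF.
have mY : measurable_fun setT (EFin \o Y).
  by apply/measurable_EFinP => _ B mB; rewrite setTI; apply: subF.2; exact: FY.
apply/eqP; rewrite eq_le measure_ge0 andbT -[A]setIT -EY // integralE.
rewrite (ae_eq_integral (cst 0%E)) //; last 2 first.
- exact: measurable_funepos.
- apply: filterS Y_le0 => w Yw _.
  by rewrite funeposE /=; apply/max_idPr; rewrite lee_fin.
rewrite integral0 sub0e oppe_le0.
by apply: integral_ge0 => w _; exact: funeneg_ge0.
Qed.

Lemma komlos_dominated d (T : measurableType d) (R : realType)
  (P : probability T R) (xi : nat -> T -> R) (a : T -> R) :
  (forall n, measurable_fun setT (xi n)) -> (forall n w, 0 <= xi n w) ->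
  measurable_fun setT a -> {ae P, forall w n, xi n w <= a w} ->
  exists (X : T -> R) (x : nat -> T -> R),
    [/\ measurable_fun setT X, (forall w, 0 <= X w),
        (forall n, in_tail_conv xi n (x n)) &
        {ae P, forall w, (fun n => x n w) @ \oo --> X w}].
Proof.
move=> mxi xi0 ma xi_le.
pose c w := 1 + `|a w|.
have c_gt0 w : 0 < c w by rewrite ltr_pwDl.
have mc : measurable_fun setT (fun w => (c w)^-1).
  apply: (measurableT_comp (f := fun r : R => (1 + `|r|)^-1)) ma.
  apply: continuous_measurable_fun => r.
  apply: (continuousV (s := fun r : R => 1 + `|r|)); first by rewrite gt_eqF // ltr_pwDl.
  exact: cvgD (cvg_cst _) (@norm_continuous _ R^o r).
(* The truncation makes g bounded everywhere; off a null set it is inactive. *)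
pose g n w := Num.min (xi n w / c w) 1.
have mg n : measurable_fun setT (g n).
  by apply: measurable_minr; [exact: measurable_funM | exact: measurable_cst].
have g01 n w : 0 <= g n w <= 1.
  by rewrite le_min ge_min lexx ler01 orbT !andbT divr_ge0 // ltW.
have [L [M [wL cvg_g]]] := komlos_bounded P mg g01.
pose x k := wsum (L k) (M k) xi.
have cvg_x : {ae P, forall w, cvgn (x^~ w)}.
  apply: filterS2 cvg_g xi_le => w cvg_gw xiw_le.
  have xi_g i : xi i w = g i w * c w.
    rewrite /g min_l ?divfK ?gt_eqF // ler_pdivrMr // mul1r.
    by apply: le_trans (xiw_le i) _; rewrite /c (le_trans (ler_norm _)) // lerDr.
  rewrite (_ : x^~ w = (fun k => wsum (L k) (M k) g w) \* (fun=> c w)).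
    exact: is_cvgM (is_cvg_cst _).
  apply/funext => k; rewrite /= -wsum_mulr /x /wsum.
  by apply: eq_bigr => i _; rewrite xi_g.
have [X [mX X0 lim_x]] := ae_cvg_measurable_limit (fun k => measurable_wsum _ _ mxi)
  (fun k w => wsum_ge0 (xi0^~ w) (wL k)) cvg_x.
exists X, x; split=> // k; exact: tail_weights_in_tail_conv.
Qed.

Theorem mainTheorem13 (d : measure_display) (T : measurableType d)
  (R : realType) (P : probability T R) (F : set (set T))
  (xi : nat -> T -> R) :
  is_subsigma F ->
  (forall n, measurable_fun setT (xi n)) ->
  (forall n w, 0 <= xi n w) ->
  (forall eps : T -> R, Fmeasurable F eps -> (forall w, 0 <= eps w) ->
     exists a : T -> R, Fmeasurable F a /\
       forall h, in_tail_conv xi 0 h ->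
         cond_prob_le P F [set w | a w <= h w] eps) ->
  exists (X : T -> R) (x : nat -> T -> R),
    [/\ measurable_fun setT X, (forall w, 0 <= X w),
        (forall n, in_tail_conv xi n (x n)) &
        {ae P, forall w, (fun n => x n w) @ \oo --> X w}].
Proof.
move=> subF mxi xi0 hyp.
have F_cst0 : Fmeasurable F (fun=> 0 : R).
  move=> B _; rewrite preimage_cst.
  by case: ifP => _; [exact: subsigma_setT | case: subF => [[]]].
have [a [Fa a_dom]] := hyp _ F_cst0 (fun=> lexx 0).
have ma : measurable_fun setT a.
  by move=> _ B mB; rewrite setTI; apply: subF.2; exact: Fa.
apply: (komlos_dominated mxi xi0 ma); apply: ae_foralln => n.
exists [set w | a w <= xi n w]; split.
- have mtrue : measurable [set true] by [].
  have := measurable_fun_ler ma (mxi n) measurableT mtrue.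
  by rewrite setTI (_ : _ @^-1` _ = [set w | a w <= xi n w]) //; apply/seteqP.
- exact: cond_prob_le0_null subF (a_dom _ (in_tail_conv_term xi n)).
- by move=> w /= /negP; rewrite -ltNge => /ltW.
Qed.
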